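(* Let $X$ be a locally compact, geodesically complete CAT(0)-space connected at infinity and let $a\colon\mathbb R\to X$ be a complete geodesic of strictly rank one. Then the displacement function $\delta$ is continuous on $Z(a)$, where $Z(a)$ carries the topology induced from $\partial_\infty X\times\partial_\infty X\times X$.
   Context: Scissors $\langle a,b,c,d;x\rangle$: complete geodesics with $a(-\infty)=b(-\infty)$, $a(+\infty)=c(+\infty)$, $c(-\infty)=d(-\infty)$, $b(+\infty)=d(+\infty)$, $b\cap c=\{x\}$. For complete geodesics $c_1,c_2$ with a common ideal endpoint $\xi$, the metric transfer $R_{c_1c_2}(c_1(t))=c_2(t)$ uses arclength parametrizations with $\beta_\xi(c_1(t))=\beta_\xi(c_2(t))$, $\beta_\xi$ a Busemann function centred at $\xi$. The scissors translation is $T=R_{ba}\circ R_{db}\circ R_{cd}\circ R_{ac}\colon a\to a$ (using the common ideal endpoints $a(+\infty)$, $c(-\infty)$, $d(+\infty)$, $a(-\infty)$ respectively), and its displacement is $\delta T=\beta_{a(-\infty)}(T(m))-\beta_{a(-\infty)}(m)$, $m\in a$. $Z(a)$ is the set of triples $(\xi,\eta,x)\in\partial_\infty X\times\partial_\infty X\times X$ for which there are scissors $\langle a,b,c,d;x\rangle$ with $b(+\infty)=\xi$, $c(-\infty)=\eta$, and $\delta(\xi,\eta,x)$ is the displacement $\delta T$ of the translation of such scissors. Strictly rank one: the geodesic does not virtually bound a flat strip (no finite chain of successively asymptotic complete geodesics starting at it and ending at a boundary line of a subset isometric to a Euclidean strip). $\partial_\infty X$ carries the cone topology. *)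

(* Defs.v *)
From Stdlib Require Import Reals Lra.
From Coquelicot Require Import Coquelicot.
Open Scope R_scope.

Section Geometry.
Context {X : Type}.
Variable dist : X -> X -> R.

Definition is_metric : Prop :=
  (forall x y, dist x y = 0 <-> x = y) /\
  (forall x y, dist x y = dist y x) /\
  (forall x y z, dist x z <= dist x y + dist y z).

Definition geod_segment (x y : X) (s : R -> X) : Prop :=
  s 0 = x /\ s (dist x y) = y /\
  forall u v, 0 <= u <= dist x y -> 0 <= v <= dist x y ->
    dist (s u) (s v) = Rabs (u - v).

Definition geod_line (c : R -> X) : Prop :=
  forall u v, dist (c u) (c v) = Rabs (u - v).

Definition geod_ray (r : R -> X) : Prop :=
  forall u v, 0 <= u -> 0 <= v -> dist (r u) (r v) = Rabs (u - v).

(** CAT(0): geodesic space whose geodesic triangles satisfy the CAT(0)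
    comparison inequality.  Two points on a triangle either lie on the same
    side (equality, automatic) or on two sides issuing from a common vertex x;
    the right-hand side is the squared distance of the comparison points in
    the Euclidean comparison triangle (law of cosines). *)
Definition CAT0 : Prop :=
  (forall x y, exists s, geod_segment x y s) /\
  (forall x y z s1 s2 u v,
     geod_segment x y s1 -> geod_segment x z s2 ->
     0 < dist x y -> 0 < dist x z ->
     0 <= u <= dist x y -> 0 <= v <= dist x z ->
     (dist (s1 u) (s2 v)) ^ 2 <=
       u ^ 2 + v ^ 2 - u * v * ((dist x y) ^ 2 + (dist x z) ^ 2 - (dist y z) ^ 2)
                          / (dist x y * dist x z)).

Definition compact_set (K : X -> Prop) : Prop :=
  forall u : nat -> X, (forall n, K (u n)) ->
    exists (phi : nat -> nat) (l : X),
      (forall n, (phi n < phi (S n))%nat) /\ K l /\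
      Un_cv (fun n => dist (u (phi n)) l) 0.

Definition locally_compact : Prop :=
  forall x, exists rho, 0 < rho /\ compact_set (fun y => dist x y <= rho).

Definition geodesically_complete : Prop :=
  forall x y s, x <> y -> geod_segment x y s ->
    exists c, geod_line c /\ forall u, 0 <= u <= dist x y -> c u = s u.

Definition continuous_path (g : R -> X) : Prop :=
  forall t, 0 <= t <= 1 -> forall eps, 0 < eps -> exists del, 0 < del /\
    forall t', 0 <= t' <= 1 -> Rabs (t' - t) < del -> dist (g t) (g t') < eps.

Definition connected_at_infinity : Prop :=
  forall C, compact_set C -> exists D, compact_set D /\ (forall x, C x -> D x) /\
    forall x y, ~ D x -> ~ D y ->
      exists g, continuous_path g /\ g 0 = x /\ g 1 = y /\
        forall t, 0 <= t <= 1 -> ~ C (g t).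

(** Ideal points are represented by geodesic rays; two rays define the same
    ideal point iff they are asymptotic. *)
Definition asym (r1 r2 : R -> X) : Prop :=
  exists C, forall t, 0 <= t -> dist (r1 t) (r2 t) <= C.

(** the rays towards c(+oo) and c(-oo) *)
Definition pend (c : R -> X) : R -> X := fun t => c t.
Definition mend (c : R -> X) : R -> X := fun t => c (- t).

Definition asym_lines (c1 c2 : R -> X) : Prop :=
  exists e1 e2 : R -> X, (e1 = pend c1 \/ e1 = mend c1) /\
                         (e2 = pend c2 \/ e2 = mend c2) /\ asym e1 e2.

Definition bounds_flat_strip (c : R -> X) : Prop :=
  exists (w : R) (F : R -> R -> X), 0 < w /\
    (forall u1 u2 s1 s2, 0 <= u1 <= w -> 0 <= u2 <= w ->
       (dist (F u1 s1) (F u2 s2)) ^ 2 = (u1 - u2) ^ 2 + (s1 - s2) ^ 2) /\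
    forall t, c t = F 0 t.

Definition strictly_rank_one (c : R -> X) : Prop :=
  ~ exists (n : nat) (g : nat -> R -> X),
      g O = c /\ (forall i, (i <= n)%nat -> geod_line (g i)) /\
      (forall i, (i < n)%nat -> asym_lines (g i) (g (S i))) /\
      bounds_flat_strip (g n).

Definition busemann_at (xi : R -> X) (beta : X -> R) : Prop :=
  exists (r : R -> X) (C : R), geod_ray r /\ asym r xi /\
    forall x, is_lim (fun t => dist x (r t) - t) p_infty (beta x - C).

(** metric transfer R_{c1 c2} along the common ideal endpoint xi:
    q = R_{c1c2}(p) *)
Definition transfer (xi : R -> X) (c1 c2 : R -> X) (p q : X) : Prop :=
  (exists t, p = c1 t) /\ (exists t, q = c2 t) /\
  exists beta, busemann_at xi beta /\ beta p = beta q.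

Definition scissors (a b c e : R -> X) (x : X) : Prop :=
  geod_line a /\ geod_line b /\ geod_line c /\ geod_line e /\
  asym (mend a) (mend b) /\ asym (pend a) (pend c) /\
  asym (mend c) (mend e) /\ asym (pend b) (pend e) /\
  (exists s, b s = x) /\ (exists t, c t = x) /\
  (forall p, (exists s, b s = p) -> (exists t, c t = p) -> p = x).

(** v is the displacement of the scissors translation
    T = R_{ba} o R_{eb} o R_{ce} o R_{ac} *)
Definition displacement (a b c e : R -> X) (v : R) : Prop :=
  exists m p1 p2 p3 p4,
    (exists s, m = a s) /\
    transfer (pend a) a c m p1 /\
    transfer (mend c) c e p1 p2 /\
    transfer (pend e) e b p2 p3 /\
    transfer (mend a) b a p3 p4 /\
    exists beta, busemann_at (mend a) beta /\ v = beta p4 - beta m.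

(** (xi, eta, x) in Z(a) with delta(xi, eta, x) = v *)
Definition delta_rel (a : R -> X) (xi eta : R -> X) (x : X) (v : R) : Prop :=
  geod_ray xi /\ geod_ray eta /\
  exists b c e, scissors a b c e x /\ asym (pend b) xi /\ asym (mend c) eta /\
    displacement a b c e v.

(** cone topology based at o: basic neighbourhoods U(xi0, R, eps) *)
Definition cone_near (o : X) (xi0 xi : R -> X) (Rr eps : R) : Prop :=
  exists rho0 rho, geod_ray rho0 /\ geod_ray rho /\ rho0 0 = o /\ rho 0 = o /\
    asym rho0 xi0 /\ asym rho xi /\ dist (rho0 Rr) (rho Rr) < eps.

End Geometry.

(* Main.v *)
(** Writing [E_l x] for the limit of [dist x (l t) + dist x (l (-t)) - 2 t], the
    four transfers telescope to [v = E_a x + E_e x], where [e] joins [eta] to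
    [xi].  The first term is Lipschitz in [x].  The second is
    [b_xi x + b_eta x - min (b_xi + b_eta)] for Busemann functions [b_xi],
    [b_eta], which depend on the ideal point continuously and uniformly on
    bounded sets; the minimum is attained on [e].  Continuity of the minimum is
    where rank one enters: a point [m] off [e] with [E_e m = 0] spans, with [e],
    a flat strip, so on a small compact sphere about a point of [e] the
    functions [b_xi] and [b_eta] cannot both be almost nonpositive. *)
Require Import Defs.
From Stdlib Require Import Reals Lra Psatz Classical ClassicalEpsilon.
From Coquelicot Require Import Coquelicot.
Open Scope R_scope.

Lemma le_of_sq_le (x y : R) : 0 <= y -> x ^ 2 <= y ^ 2 -> x <= y.
Proof. intros; nra. Qed.

(** * Comparison inequalities in CAT(0) spaces *)

Section CAT0Space.
Context {X : Type} (dist : X -> X -> R).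
Context (Hm : is_metric dist) (Hc : CAT0 dist).

Lemma dist_refl (x : X) : dist x x = 0.
Proof. now apply Hm. Qed.

Lemma dist_sym (x y : X) : dist x y = dist y x.
Proof. now apply Hm. Qed.

Lemma dist_triangle (x y z : X) : dist x z <= dist x y + dist y z.
Proof. now apply Hm. Qed.

Lemma dist_eq0 (x y : X) : dist x y = 0 -> x = y.
Proof. now apply Hm. Qed.

Lemma dist_nonneg (x y : X) : 0 <= dist x y.
Proof.
  pose proof (dist_triangle x y x); rewrite dist_refl, (dist_sym y x) in H; lra.
Qed.

(** Stewart's identity in the Euclidean comparison triangle: [CAT0] is applied with the second point
    at the vertex [p]. [CAT0] asks for positive side lengths, so degenerate triangles are settled
    first. *)
Lemma stewart (x y : X) (s : R -> X) (l : R) (p : X) :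
  geod_segment dist x y s -> 0 <= l <= 1 ->
  dist p (s (l * dist x y)) ^ 2 <=
    (1 - l) * dist p x ^ 2 + l * dist p y ^ 2 - l * (1 - l) * dist x y ^ 2.
Proof.
  intros Hs Hl.
  pose proof (dist_nonneg x y) as Hxy; pose proof (dist_nonneg x p) as Hxp.
  destruct (Req_dec (dist x y) 0) as [E|E].
  { destruct Hs as (Hs0 & _). rewrite E, Rmult_0_r, Hs0, <- (dist_eq0 _ _ E). nra. }
  destruct (Req_dec (dist x p) 0) as [E'|E'].
  { apply dist_eq0 in E'; subst p.
    destruct Hs as (Hs0 & _ & Hs). rewrite dist_refl.
    rewrite <- Hs0 at 1. rewrite Hs by (split; nra).
    replace (Rabs (0 - l * dist x y)) with (l * dist x y)
      by (rewrite Rabs_minus_sym, Rminus_0_r, Rabs_pos_eq; nra).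
    nra. }
  destruct Hc as [Hg Hc'].
  destruct (Hg x p) as (s2 & Hs2).
  assert (H := Hc' x y p s s2 (l * dist x y) (dist x p) Hs Hs2
    ltac:(lra) ltac:(lra) ltac:(split; nra) ltac:(lra)).
  destruct Hs2 as (_ & Hs2 & _). rewrite Hs2 in H.
  rewrite (dist_sym p (s _)), (dist_sym p x), (dist_sym p y).
  eapply Rle_trans; [exact H|]. apply Req_le. field. lra.
Qed.

Lemma stewart_ray (r : R -> X) (u w l : R) (p : X) :
  geod_ray dist r -> 0 <= u <= w -> 0 <= l <= 1 ->
  dist p (r (u + l * (w - u))) ^ 2 <=
    (1 - l) * dist p (r u) ^ 2 + l * dist p (r w) ^ 2 - l * (1 - l) * (w - u) ^ 2.
Proof.
  intros Hr Hu Hl.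
  assert (E : dist (r u) (r w) = w - u)
    by (rewrite Hr, Rabs_minus_sym, Rabs_pos_eq; lra).
  assert (Hs : geod_segment dist (r u) (r w) (fun t => r (u + t))).
  { repeat split.
    - f_equal; lra.
    - f_equal; lra.
    - intros v v' Hv Hv'. rewrite Hr by lra. f_equal; lra. }
  pose proof (stewart _ _ _ l p Hs Hl) as H. now rewrite E in H.
Qed.

Lemma line_ray (c : R -> X) : geod_line dist c -> geod_ray dist (pend c).
Proof. intros H u v _ _; apply H. Qed.

Lemma line_mray (c : R -> X) : geod_line dist c -> geod_ray dist (mend c).
Proof.
  intros H u v _ _; unfold mend; rewrite H, Rabs_minus_sym; f_equal; lra.
Qed.

(** Equivalently, [dist p (c t) ^ 2 - t ^ 2] is midpoint convex in [t]; this later turns upper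
    bounds along a line into equalities. *)
Lemma line_midpoint (c : R -> X) (s t : R) (p : X) :
  geod_line dist c -> 0 <= t ->
  2 * dist p (c s) ^ 2 <= dist p (c (s + t)) ^ 2 + dist p (c (s - t)) ^ 2 - 2 * t ^ 2.
Proof.
  intros H Ht.
  assert (Hr : geod_ray dist (fun u => c (s - t + u)))
    by (intros u v _ _; rewrite H; f_equal; lra).
  pose proof (stewart_ray _ 0 (2 * t) (/ 2) p Hr ltac:(lra) ltac:(lra)) as H1.
  cbv beta in H1.
  replace (s - t + (0 + / 2 * (2 * t - 0))) with s in H1 by lra.
  replace (s - t + 0) with (s - t) in H1 by lra.
  replace (s - t + 2 * t) with (s + t) in H1 by lra.
  nra.
Qed.

(** Stewart's inequality bounds the distances from [y] and [w] to the midpoint [m] of [x] and [z];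
    the triangle inequality through [m] then bounds [dist y w]. *)
Lemma quadrilateral (x y z w : X) :
  dist x z ^ 2 + dist y w ^ 2 <=
    dist x y ^ 2 + dist y z ^ 2 + dist z w ^ 2 + dist w x ^ 2.
Proof.
  destruct Hc as [Hg _]. destruct (Hg x z) as (s & Hs).
  pose proof (stewart _ _ _ (/ 2) y Hs ltac:(lra)) as H1.
  pose proof (stewart _ _ _ (/ 2) w Hs ltac:(lra)) as H2.
  set (m := s (/ 2 * dist x z)) in *.
  pose proof (dist_triangle y m w) as H3.
  rewrite (dist_sym m w) in H3. rewrite (dist_sym y x) in H1. rewrite (dist_sym w z) in H2.
  pose proof (dist_nonneg y w). pose proof (dist_nonneg y m). pose proof (dist_nonneg w m).
  assert (dist y w ^ 2 <= 2 * dist y m ^ 2 + 2 * dist w m ^ 2)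
    by (pose proof (pow2_ge_0 (dist y m - dist w m)); nra).
  lra.
Qed.

(** * Asymptotic rays and Busemann functions *)

Lemma asym_sym (r r' : R -> X) : asym dist r r' -> asym dist r' r.
Proof.
  intros (C & H); exists C; intros t Ht; rewrite dist_sym; auto.
Qed.

Lemma asym_trans (r1 r2 r3 : R -> X) :
  asym dist r1 r2 -> asym dist r2 r3 -> asym dist r1 r3.
Proof.
  intros (C & H) (D & H'); exists (C + D); intros t Ht.
  pose proof (dist_triangle (r1 t) (r2 t) (r3 t)).
  specialize (H t Ht); specialize (H' t Ht); lra.
Qed.

Lemma asym_refl (r : R -> X) : asym dist r r.
Proof. exists 0; intros; rewrite dist_refl; lra. Qed.

(** In contrast to [busemann_at], the ray is fixed and there is no additive constant: for a geodesic
    ray the function vanishes at [r 0]. *)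
Definition is_busemann (r : R -> X) (b : X -> R) : Prop :=
  forall x eps, 0 < eps -> exists M, forall t, M < t ->
    Rabs (dist x (r t) - t - b x) < eps.

(** By the triangle inequality [t - dist x (r t)] is nondecreasing and bounded by [dist x (r 0)], so
    it converges to its supremum. *)
Lemma busemann_exists (r : R -> X) :
  geod_ray dist r -> exists b, is_busemann r b.
Proof.
  intros Hr.
  set (E := fun x v => exists t, 0 <= t /\ v = t - dist x (r t)).
  assert (Hb : forall x, bound (E x)).
  { intros x; exists (dist x (r 0)); intros v (t & Ht & ->).
    pose proof (dist_triangle (r 0) x (r t)) as H.
    rewrite (Hr 0 t), Rabs_minus_sym, Rabs_pos_eq, (dist_sym (r 0) x) in H; lra. }
  assert (He : forall x, exists v, E x v)
    by (intros x; exists (0 - dist x (r 0)), 0; split; [lra|reflexivity]).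
  exists (fun x => - proj1_sig (completeness (E x) (Hb x) (He x))).
  intros x eps Heps.
  destruct (completeness (E x) (Hb x) (He x)) as (m & Hub & Hlub); simpl.
  destruct (classic (exists t, 0 <= t /\ m - eps < t - dist x (r t))) as [(t0 & Ht0 & H0)|N].
  - exists t0; intros t Ht.
    assert (t - dist x (r t) <= m) by (apply Hub; exists t; split; [lra|reflexivity]).
    pose proof (dist_triangle x (r t0) (r t)) as H1.
    rewrite (Hr t0 t), Rabs_minus_sym, Rabs_pos_eq in H1 by lra.
    apply Rabs_def1; lra.
  - assert (m <= m - eps); [|lra].
    apply Hlub. intros v (t & Ht & ->).
    apply Rnot_lt_le; intros C; apply N; exists t; split; [lra|exact C].
Qed.

Section Busemann.
Context (r : R -> X) (b : X -> R) (Hr : geod_ray dist r) (Hb : is_busemann r b).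

Lemma busemann_le (x : X) (t : R) : 0 <= t -> b x <= dist x (r t) - t.
Proof.
  intros Ht. apply Rnot_lt_le; intros C.
  destruct (Hb x (b x - (dist x (r t) - t)) ltac:(lra)) as (M & HM).
  pose proof (Rmax_l M t); pose proof (Rmax_r M t).
  specialize (HM (Rmax M t + 1) ltac:(lra)).
  set (u := Rmax M t + 1) in *. assert (Hu : t < u) by (unfold u; lra).
  pose proof (dist_triangle x (r t) (r u)) as H1.
  rewrite (Hr t u), Rabs_minus_sym, Rabs_pos_eq in H1 by lra.
  apply Rabs_def2 in HM. lra.
Qed.

(** Stewart's inequality at time [T] on the segment from [r 0] to [r t], as [t] tends to infinity.
    In Euclidean space this is an equality, the law of cosines. *)
Lemma busemann_ge (x : X) (T : R) :
  0 <= T -> dist x (r T) ^ 2 <= dist x (r 0) ^ 2 + T ^ 2 + 2 * T * b x.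
Proof.
  intros HT. destruct (Req_dec T 0) as [->|HT0]; [lra|].
  apply Rnot_lt_le; intros C.
  set (g := dist x (r T) ^ 2 - (dist x (r 0) ^ 2 + T ^ 2 + 2 * T * b x)).
  assert (Hg : 0 < g) by (unfold g; lra).
  (* Two errors of at most [2 * T * e] will appear, one from replacing [dist x (r t) - t] by [b x]
     and one from the remainder in [1 / t]; together they use up the excess [g]. *)
  set (e := g / (4 * T)).
  assert (He : 0 < e) by (apply Rdiv_lt_0_compat; lra).
  assert (Eg : g = 4 * T * e) by (unfold e; field; lra).
  destruct (Hb x e He) as (M & HM).
  (* Beyond [N] the remainder [(b x + e) ^ 2 / t] is below [2 * e]. *)
  set (N := (b x + e) ^ 2 / (2 * e)).
  set (t := Rmax M (Rmax T N) + 1).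
  assert (Ht : M < t /\ T < t /\ N < t).
  { unfold t. pose proof (Rmax_l M (Rmax T N)); pose proof (Rmax_r M (Rmax T N)).
    pose proof (Rmax_l T N); pose proof (Rmax_r T N). lra. }
  destruct Ht as (Ht1 & Ht2 & Ht3).
  specialize (HM t Ht1). apply Rabs_def2 in HM.
  pose proof (stewart_ray r 0 t (T / t) x Hr ltac:(lra)) as H.
  assert (HTt : 0 <= T / t <= 1).
  { split; [apply Rdiv_le_0_compat; lra|].
    apply (Rmult_le_reg_r t); [lra|]. unfold Rdiv; rewrite Rmult_assoc, Rinv_l; lra. }
  specialize (H HTt).
  replace (0 + T / t * (t - 0)) with T in H by (field; lra).
  pose proof (dist_nonneg x (r t)).
  assert (HD : dist x (r t) ^ 2 <= (t + b x + e) ^ 2) by (apply pow_incr; lra).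
  assert (HN : (b x + e) ^ 2 < 2 * e * t).
  { replace ((b x + e) ^ 2) with (2 * e * N) by (unfold N; field; lra). nra. }
  assert (H2 : T / t * dist x (r t) ^ 2 <= T / t * (t + b x + e) ^ 2)
    by (apply Rmult_le_compat_l; lra).
  assert (H3 : T / t * (t + b x + e) ^ 2 - T / t * (1 - T / t) * (t - 0) ^ 2
     = T ^ 2 + 2 * T * (b x + e) + T * ((b x + e) ^ 2 / t)) by (field; lra).
  assert (H4 : (b x + e) ^ 2 / t < 2 * e).
  { apply (Rmult_lt_reg_r t); [lra|]. unfold Rdiv; rewrite Rmult_assoc, Rinv_l; lra. }
  assert (H5 : T * ((b x + e) ^ 2 / t) < T * (2 * e)) by (apply Rmult_lt_compat_l; lra).
  pose proof (pow2_ge_0 (dist x (r 0))).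
  assert (H6 : (1 - T / t) * dist x (r 0) ^ 2 <= dist x (r 0) ^ 2) by nra.
  unfold g in Eg. lra.
Qed.

(** Together with [busemann_le] this determines [b x] from the single point [r T], with an error of
    order [1 / T] that is uniform on bounded sets. *)
Lemma busemann_estimate (x : X) (T : R) :
  0 < T -> dist x (r T) - T - dist x (r 0) ^ 2 / (2 * T) <= b x.
Proof.
  intros HT. pose proof (busemann_ge x T ltac:(lra)) as H.
  apply (Rmult_le_reg_l (2 * T)); [lra|].
  replace (2 * T * (dist x (r T) - T - dist x (r 0) ^ 2 / (2 * T)))
    with (2 * T * (dist x (r T) - T) - dist x (r 0) ^ 2) by (field; lra).
  pose proof (pow2_ge_0 (dist x (r T) - T)). nra.
Qed.

Lemma busemann_lipschitz (x y : X) : b x - b y <= dist x y.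
Proof.
  apply Rle_plus_epsilon; intros e He.
  destruct (Hb x (e / 2) ltac:(lra)) as (M & HM).
  destruct (Hb y (e / 2) ltac:(lra)) as (N & HN).
  pose proof (Rmax_l M N); pose proof (Rmax_r M N).
  specialize (HM (Rmax M N + 1) ltac:(lra)); specialize (HN (Rmax M N + 1) ltac:(lra)).
  apply Rabs_def2 in HM; apply Rabs_def2 in HN.
  pose proof (dist_triangle x y (r (Rmax M N + 1))). lra.
Qed.

(** Horoballs are convex as limits of balls: by Stewart's inequality the ball of radius [t + m + e]
    about [r t] is convex. *)
Lemma busemann_quasiconvex (x y : X) (s : R -> X) (l m : R) :
  geod_segment dist x y s -> 0 <= l <= 1 -> b x <= m -> b y <= m ->
  b (s (l * dist x y)) <= m.
Proof.
  intros Hs Hl Hx Hy. set (q := s (l * dist x y)).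
  apply Rle_plus_epsilon; intros e He.
  destruct (Hb x e He) as (M & HM).
  destruct (Hb y e He) as (N & HN).
  set (t := Rmax (Rmax M N) 0 + 1).
  assert (Ht : M < t /\ N < t /\ 0 < t).
  { unfold t. pose proof (Rmax_l (Rmax M N) 0); pose proof (Rmax_r (Rmax M N) 0).
    pose proof (Rmax_l M N); pose proof (Rmax_r M N). lra. }
  specialize (HM t ltac:(lra)); specialize (HN t ltac:(lra)).
  apply Rabs_def2 in HM; apply Rabs_def2 in HN.
  pose proof (stewart _ _ _ l (r t) Hs Hl) as H. fold q in H.
  rewrite !(dist_sym (r t)) in H.
  pose proof (dist_nonneg x (r t)); pose proof (dist_nonneg y (r t)).
  assert (K1 : dist x (r t) ^ 2 <= (t + m + e) ^ 2) by (apply pow_incr; lra).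
  assert (K2 : dist y (r t) ^ 2 <= (t + m + e) ^ 2) by (apply pow_incr; lra).
  pose proof (pow2_ge_0 (dist x y)).
  assert (K3 : dist q (r t) ^ 2 <= (t + m + e) ^ 2).
  { assert (0 <= l * (1 - l) * dist x y ^ 2)
      by (apply Rmult_le_pos; [nra|lra]).
    assert ((1 - l) * dist x (r t) ^ 2 <= (1 - l) * (t + m + e) ^ 2)
      by (apply Rmult_le_compat_l; lra).
    assert (l * dist y (r t) ^ 2 <= l * (t + m + e) ^ 2)
      by (apply Rmult_le_compat_l; lra).
    lra. }
  apply le_of_sq_le in K3; [|lra].
  pose proof (busemann_le q t ltac:(lra)). lra.
Qed.

End Busemann.

(** The quadrilateral inequality for [x], [y], [r t], [r' t] bounds a difference of differences of
    squared distances independently of [t]. Factoring the squares and dividing by the sum of the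
    distances, which grows like [2 * t], leaves the claim in the limit. *)
Lemma busemann_asym_le (r r' : R -> X) (b b' : X -> R) (x y : X) :
  asym dist r r' -> is_busemann r b -> is_busemann r' b' ->
  b x - b y <= b' x - b' y.
Proof.
  intros (D & HD) Hb Hb'. apply Rnot_lt_le; intros C.
  set (d := b x - b y - (b' x - b' y)). assert (Hd : 0 < d) by (unfold d; lra).
  destruct (Hb x (d / 8) ltac:(lra)) as (M1 & H1).
  destruct (Hb y (d / 8) ltac:(lra)) as (M2 & H2).
  destruct (Hb' x (d / 8) ltac:(lra)) as (M3 & H3).
  destruct (Hb' y (d / 8) ltac:(lra)) as (M4 & H4).
  assert (HD0 : 0 <= D) by (specialize (HD 0 (Rle_refl 0)); pose proof (dist_nonneg (r 0) (r' 0)); lra).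
  (* The first two terms come from the quadrilateral, the last from replacing [A' + B'] by [A + B],
     which differ by at most [2 * D]. *)
  set (C0 := dist x y ^ 2 + D ^ 2 + 2 * D * dist x y).
  (* As [A + B] exceeds [2 * t + b x + b y - d / 4], times beyond [N] give
     [C0 < d / 2 * (A + B)]. *)
  set (N := (d / 4 - b x - b y) / 2 + C0 / d).
  set (t := Rmax (Rmax M1 M2) (Rmax (Rmax M3 M4) (Rmax 0 N)) + 1).
  assert (Ht : M1 < t /\ M2 < t /\ M3 < t /\ M4 < t /\ 0 < t /\ N < t).
  { unfold t.
    pose proof (Rmax_l (Rmax M1 M2) (Rmax (Rmax M3 M4) (Rmax 0 N))).
    pose proof (Rmax_r (Rmax M1 M2) (Rmax (Rmax M3 M4) (Rmax 0 N))).
    pose proof (Rmax_l (Rmax M3 M4) (Rmax 0 N)); pose proof (Rmax_r (Rmax M3 M4) (Rmax 0 N)).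
    pose proof (Rmax_l M1 M2); pose proof (Rmax_r M1 M2).
    pose proof (Rmax_l M3 M4); pose proof (Rmax_r M3 M4).
    pose proof (Rmax_l 0 N); pose proof (Rmax_r 0 N). lra. }
  specialize (H1 t ltac:(lra)); specialize (H2 t ltac:(lra)).
  specialize (H3 t ltac:(lra)); specialize (H4 t ltac:(lra)).
  specialize (HD t ltac:(lra)).
  apply Rabs_def2 in H1; apply Rabs_def2 in H2; apply Rabs_def2 in H3; apply Rabs_def2 in H4.
  pose proof (quadrilateral x y (r t) (r' t)) as Q.
  pose proof (dist_triangle x (r t) (r' t)) as T1.
  pose proof (dist_triangle y (r t) (r' t)) as T2.
  pose proof (dist_triangle x (r' t) (r t)) as T3.
  pose proof (dist_triangle y (r' t) (r t)) as T4.
  pose proof (dist_triangle x y (r' t)) as T5.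
  pose proof (dist_triangle y x (r' t)) as T6.
  pose proof (dist_nonneg (r t) (r' t)) as P.
  rewrite (dist_sym (r' t) x) in Q.
  rewrite (dist_sym (r' t) (r t)) in T3, T4. rewrite (dist_sym y x) in T6.
  set (A := dist x (r t)) in *. set (B := dist y (r t)) in *.
  set (A' := dist x (r' t)) in *. set (B' := dist y (r' t)) in *.
  set (p := dist (r t) (r' t)) in *. set (z := dist x y) in *.
  assert (HAB : (A - B - (A' - B')) * (A + B) <= C0).
  { assert ((A' - B') * (A' + B' - (A + B)) <= z * (2 * D)).
    { apply Rle_trans with (Rabs (A' - B') * Rabs (A' + B' - (A + B))).
      - rewrite <- Rabs_mult. apply Rle_abs.
      - apply Rmult_le_compat; try apply Rabs_pos; apply Rabs_le; lra. }
    assert (p ^ 2 <= D ^ 2) by (apply pow_incr; lra).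
    unfold C0. nra. }
  assert (HN : C0 < d / 2 * (A + B)).
  { assert (d * N = d * ((d / 4 - b x - b y) / 2) + C0) by (unfold N; field; lra).
    nra. }
  assert (d / 2 * (A + B) <= (A - B - (A' - B')) * (A + B)).
  { apply Rmult_le_compat_r; [|unfold d in *; lra].
    unfold A, B. pose proof (dist_nonneg x (r t)); pose proof (dist_nonneg y (r t)); lra. }
  lra.
Qed.

Lemma busemann_asym (r r' : R -> X) (b b' : X -> R) (x y : X) :
  asym dist r r' -> is_busemann r b -> is_busemann r' b' ->
  b x - b y = b' x - b' y.
Proof.
  intros Ha Hb Hb'.
  apply Rle_antisym; [now apply (busemann_asym_le r r')|].
  apply (busemann_asym_le r' r); auto. now apply asym_sym.
Qed.

(** The free ray and the additive constant of [busemann_at] both cancel in differences, so every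
    transfer can be expressed with one fixed Busemann function per ideal point. *)
Lemma busemann_at_diff (xi r : R -> X) (beta b : X -> R) (x y : X) :
  asym dist r xi -> is_busemann r b -> busemann_at dist xi beta ->
  beta x - beta y = b x - b y.
Proof.
  intros Ha Hb (r' & C & Hr' & Ha' & Hl).
  assert (Hb' : is_busemann r' (fun x => beta x - C)).
  { intros z eps Heps. specialize (Hl z). apply is_lim_spec in Hl.
    destruct (Hl (mkposreal eps Heps)) as (M & HM). exists M; exact HM. }
  assert (Ha2 : asym dist r r') by (eapply asym_trans; [eauto|now apply asym_sym]).
  pose proof (busemann_asym r r' b _ x y Ha2 Hb Hb'). simpl in H; lra.
Qed.

(** * Busemann functions along lines and the displacement formula *)

Lemma busemann_pend (c : R -> X) (b : X -> R) (s : R) :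
  geod_line dist c -> is_busemann (pend c) b -> b (c s) = - s.
Proof.
  intros H Hb.
  assert (K : forall e, 0 < e -> Rabs (b (c s) + s) < e).
  { intros e He. destruct (Hb (c s) e He) as (M & HM).
    pose proof (Rmax_l M s); pose proof (Rmax_r M s).
    specialize (HM (Rmax M s + 1) ltac:(lra)). unfold pend in HM.
    rewrite H, (Rabs_minus_sym s) in HM. rewrite (Rabs_pos_eq (_ - s)) in HM by lra.
    rewrite <- Rabs_Ropp. eapply Rle_lt_trans; [|exact HM].
    apply Req_le; f_equal; lra. }
  destruct (Req_dec (b (c s) + s) 0); [lra|].
  specialize (K _ (Rabs_pos_lt _ H0)); lra.
Qed.

Lemma busemann_mend (c : R -> X) (b : X -> R) (s : R) :
  geod_line dist c -> is_busemann (mend c) b -> b (c s) = s.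
Proof.
  intros H Hb.
  assert (H' : geod_line dist (mend c)) by (intros u v; unfold mend; rewrite H, Rabs_minus_sym; f_equal; lra).
  pose proof (busemann_pend (mend c) b (- s) H' Hb) as K. unfold mend in K.
  rewrite Ropp_involutive in K; exact K.
Qed.

Lemma busemann_along_pend (c r : R -> X) (b : X -> R) (s : R) :
  geod_line dist c -> asym dist r (pend c) -> is_busemann r b ->
  b (c s) = b (c 0) - s.
Proof.
  intros H Ha Hb. destruct (busemann_exists _ (line_ray c H)) as (b' & Hb').
  pose proof (busemann_asym _ _ _ _ (c s) (c 0) Ha Hb Hb') as E.
  rewrite !(busemann_pend c b') in E by assumption. lra.
Qed.

Lemma busemann_along_mend (c r : R -> X) (b : X -> R) (s : R) :
  geod_line dist c -> asym dist r (mend c) -> is_busemann r b ->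
  b (c s) = b (c 0) + s.
Proof.
  intros H Ha Hb. destruct (busemann_exists _ (line_mray c H)) as (b' & Hb').
  pose proof (busemann_asym _ _ _ _ (c s) (c 0) Ha Hb Hb') as E.
  rewrite !(busemann_mend c b') in E by assumption. lra.
Qed.

(** The sum is constant on [c], and elsewhere it is at least that constant by the triangle
    inequality from [c t] to [c (- t)] through [x]. *)
Lemma busemann_sum_min (c r r' : R -> X) (b b' : X -> R) (s : R) (x : X) :
  geod_line dist c -> asym dist r (pend c) -> asym dist r' (mend c) ->
  is_busemann r b -> is_busemann r' b' ->
  b (c s) + b' (c s) <= b x + b' x.
Proof.
  intros H Ha Ha' Hb Hb'.
  destruct (busemann_exists _ (line_ray c H)) as (p & Hp).
  destruct (busemann_exists _ (line_mray c H)) as (q & Hq).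
  pose proof (busemann_asym _ _ _ _ (c s) x Ha Hb Hp) as E.
  pose proof (busemann_asym _ _ _ _ (c s) x Ha' Hb' Hq) as E'.
  rewrite (busemann_pend c p) in E by assumption.
  rewrite (busemann_mend c q) in E' by assumption.
  assert (0 <= p x + q x); [|lra].
  apply Rle_plus_epsilon; intros e He.
  destruct (Hp x (e / 2) ltac:(lra)) as (M & HM).
  destruct (Hq x (e / 2) ltac:(lra)) as (N & HN).
  set (t := Rmax (Rmax M N) 0 + 1).
  assert (Ht : M < t /\ N < t /\ 0 < t).
  { unfold t. pose proof (Rmax_l (Rmax M N) 0); pose proof (Rmax_r (Rmax M N) 0).
    pose proof (Rmax_l M N); pose proof (Rmax_r M N). lra. }
  specialize (HM t ltac:(lra)); specialize (HN t ltac:(lra)).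
  apply Rabs_def2 in HM; apply Rabs_def2 in HN. unfold pend, mend in *.
  pose proof (dist_triangle (c t) x (c (- t))) as T.
  rewrite H, Rabs_pos_eq, (dist_sym (c t) x) in T by lra. lra.
Qed.

(** Each transfer preserves one Busemann function, and on each line the functions of its two ends
    have constant sum. The sums on [c] and [b] are evaluated at their common point [x], the one on
    [e] at [e 0]. The rays [rp] and [rm] are left free so that rays from the base point of the cone
    topology can be used. *)
Lemma displacement_eq (a b c e rp rm : R -> X) (x : X) (v : R) (ap am ep em : X -> R) :
  scissors dist a b c e x -> displacement dist a b c e v ->
  is_busemann (pend a) ap -> is_busemann (mend a) am ->
  asym dist rp (pend e) -> asym dist rm (mend e) ->
  is_busemann rp ep -> is_busemann rm em ->
  v = ap x + am x + (ep x + em x - (ep (e 0) + em (e 0))).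
Proof.
  intros (La & Lb & Lc & Le & Aab & Aac & Ace & Abe & (sx & Hsx) & (tx & Htx) & _)
    (m & p1 & p2 & p3 & p4 & (sm & Em) & (_ & (t1 & E1) & B1 & HB1 & Q1)
      & (_ & (t2 & E2) & B2 & HB2 & Q2) & (_ & (t3 & E3) & B3 & HB3 & Q3)
      & (_ & _ & B4 & HB4 & Q4) & B5 & HB5 & ->) Hap Ham Arp Arm Hep Hem.
  pose proof (busemann_at_diff _ _ _ _ m p1 (asym_refl _) Hap HB1) as D1.
  pose proof (busemann_at_diff _ _ _ _ p1 p2 (asym_trans _ _ _ Arm (asym_sym _ _ Ace)) Hem HB2) as D2.
  pose proof (busemann_at_diff _ _ _ _ p2 p3 Arp Hep HB3) as D3.
  pose proof (busemann_at_diff _ _ _ _ p3 p4 (asym_refl _) Ham HB4) as D4.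
  pose proof (busemann_at_diff _ _ _ _ p4 m (asym_refl _) Ham HB5) as D5.
  rewrite D5.
  assert (ap m = - sm /\ am m = sm) as (F1 & F2).
  { subst m; split; [now apply busemann_pend|now apply busemann_mend]. }
  pose proof (busemann_along_pend c _ _ t1 Lc Aac Hap) as G1.
  pose proof (busemann_along_pend c _ _ tx Lc Aac Hap) as G2.
  assert (Arc : asym dist rm (mend c)) by (eapply asym_trans; [eauto|now apply asym_sym]).
  pose proof (busemann_along_mend c _ _ t1 Lc Arc Hem) as G3.
  pose proof (busemann_along_mend c _ _ tx Lc Arc Hem) as G4.
  pose proof (busemann_along_mend e _ _ t2 Le Arm Hem) as G5.
  pose proof (busemann_along_pend e _ _ t2 Le Arp Hep) as G6.
  assert (Arb : asym dist rp (pend b)) by (eapply asym_trans; [eauto|now apply asym_sym]).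
  pose proof (busemann_along_pend b _ _ t3 Lb Arb Hep) as G7.
  pose proof (busemann_along_pend b _ _ sx Lb Arb Hep) as G8.
  pose proof (busemann_along_mend b _ _ t3 Lb Aab Ham) as G9.
  pose proof (busemann_along_mend b _ _ sx Lb Aab Ham) as G10.
  rewrite Hsx in *; rewrite Htx in *; rewrite <- E1 in *; rewrite <- E2 in *; rewrite <- E3 in *.
  lra.
Qed.

(** * Flat strips and the rank one gap *)

Section FlatStrip.
Context (c : R -> X) (Lc : geod_line dist c) (m : X) (r s0 : R) (Hr : 0 < r).
Context (Hm_c : forall s, dist m (c s) ^ 2 = r ^ 2 + (s - s0) ^ 2).

(** In Fermi coordinates [(u, s)] along [c] the point [m] is [(r, s0)]; the
    Euclidean line from [m] through [(u, s)] reaches [c] at time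
    [strip_foot u s], and [(u, s)] cuts this segment in the ratio
    [1 - u / r]. *)
Definition strip_foot (u s : R) : R := (s - s0 * (u / r)) / (1 - u / r).

(** Only the Stewart inequality of the dividing point is recorded, tested against every [p]; all
    distance estimates below derive from it. *)
Definition strip_point (u s : R) (q : X) : Prop :=
  forall p, dist p q ^ 2 <=
    u / r * dist p m ^ 2 + (1 - u / r) * dist p (c (strip_foot u s)) ^ 2
    - (1 - u / r) * (u / r) * (r ^ 2 + (strip_foot u s - s0) ^ 2).

Lemma strip_point_exists (u s : R) : 0 <= u <= r -> exists q, strip_point u s q.
Proof.
  intros Hu. destruct (proj1 Hc m (c (strip_foot u s))) as (g & Hg).
  assert (Hl : 0 <= u / r <= 1).
  { split; [apply Rdiv_le_0_compat; lra|].
    apply (Rmult_le_reg_r r); [lra|]. unfold Rdiv; rewrite Rmult_assoc, Rinv_l; lra. }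
  exists (g ((1 - u / r) * dist m (c (strip_foot u s)))). intros p.
  pose proof (stewart _ _ _ (1 - u / r) p Hg ltac:(lra)) as H.
  rewrite Hm_c in H. lra.
Qed.

Lemma strip_point_base (s : R) (q : X) : strip_point 0 s q -> q = c s.
Proof.
  intros H. specialize (H (c s)).
  assert (E : strip_foot 0 s = s) by (unfold strip_foot; field; lra).
  rewrite E, dist_refl in H. replace (0 / r) with 0 in H by (field; lra).
  symmetry; apply dist_eq0. pose proof (dist_nonneg (c s) q). nra.
Qed.

(** Half the distance to the vertex keeps the denominator [1 - u / r] of [strip_foot] away from
    zero. *)
Lemma strip_ratio (u : R) : 0 <= u <= r / 2 -> 0 <= u / r <= / 2.
Proof.
  intros Hu. split; [apply Rdiv_le_0_compat; lra|].
  apply (Rmult_le_reg_r r); [lra|]. unfold Rdiv; rewrite Rmult_assoc, Rinv_l; lra.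
Qed.

Lemma strip_dist_vertex (u s : R) (q : X) :
  0 <= u <= r / 2 -> strip_point u s q ->
  dist m q ^ 2 <= (r - u) ^ 2 + (s - s0) ^ 2.
Proof.
  intros Hu H. specialize (H m). rewrite dist_refl, Hm_c in H.
  eapply Rle_trans; [exact H|]. apply Req_le. unfold strip_foot. field.
  lra.
Qed.

Lemma strip_dist_base_le (u s : R) (q : X) (t : R) :
  0 <= u <= r / 2 -> strip_point u s q ->
  dist (c t) q ^ 2 <= u ^ 2 + (t - s) ^ 2.
Proof.
  intros Hu H. specialize (H (c t)). rewrite (dist_sym (c t) m), Hm_c, Lc, pow2_abs in H.
  eapply Rle_trans; [exact H|]. apply Req_le. unfold strip_foot. field.
  lra.
Qed.

(* Equality at the foot forces equality everywhere: the defect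
   [t |-> dist (c t) q ^ 2 - (u ^ 2 + (t - s) ^ 2)] is midpoint convex,
   nonpositive, and vanishes at one point. *)
Lemma strip_dist_base (u s : R) (q : X) (t : R) :
  0 <= u <= r / 2 -> strip_point u s q ->
  dist (c t) q ^ 2 = u ^ 2 + (t - s) ^ 2.
Proof.
  intros Hu H. apply Rle_antisym; [now apply strip_dist_base_le|].
  pose proof (strip_ratio u Hu) as Hl.
  set (S := strip_foot u s).
  (* At the foot, the upper bound on [dist m q] and the triangle inequality through [q] give the
     missing lower bound. *)
  assert (E0 : dist (c S) q ^ 2 = u ^ 2 + (S - s) ^ 2).
  { apply Rle_antisym; [now apply strip_dist_base_le|].
    set (L := dist m (c S)). set (l := u / r) in *.
    assert (EL : L ^ 2 = r ^ 2 + (S - s0) ^ 2) by apply Hm_c.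
    assert (HL : 0 <= L) by apply dist_nonneg.
    assert (H1 : dist m q <= (1 - l) * L).
    { apply le_of_sq_le; [nra|]. specialize (H m). rewrite dist_refl in H.
      fold S l L in H. rewrite <- EL in H. nra. }
    pose proof (dist_triangle m q (c S)) as T. rewrite (dist_sym q) in T. fold L in T.
    assert (H2 : l * L <= dist (c S) q) by nra.
    assert (H3 : (l * L) ^ 2 <= dist (c S) q ^ 2) by (apply pow_incr; split; nra).
    eapply Rle_trans; [|exact H3]. rewrite Rpow_mult_distr, EL.
    apply Req_le. unfold l, S, strip_foot. field. unfold l in Hl. lra. }
  assert (K : forall h, 0 <= h ->
    2 * (u ^ 2 + (S - s) ^ 2) <=
      dist (c (S + h)) q ^ 2 + dist (c (S - h)) q ^ 2 - 2 * h ^ 2).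
  { intros h Hh. rewrite <- E0, !(dist_sym _ q). now apply line_midpoint. }
  destruct (Rle_dec S t) as [Ht|Ht].
  - specialize (K (t - S) ltac:(lra)).
    replace (S + (t - S)) with t in K by lra.
    pose proof (strip_dist_base_le u s q (S - (t - S)) Hu H). lra.
  - specialize (K (S - t) ltac:(lra)).
    replace (S - (S - t)) with t in K by lra.
    pose proof (strip_dist_base_le u s q (S + (S - t)) Hu H). lra.
Qed.

(** The inequality defining [q2] is tested at [q1], whose distance to [m] is bounded and whose
    distances to [c] are known exactly. *)
Lemma strip_dist_le (u1 s1 u2 s2 : R) (q1 q2 : X) :
  0 <= u1 <= r / 2 -> 0 <= u2 <= r / 2 ->
  strip_point u1 s1 q1 -> strip_point u2 s2 q2 ->
  dist q1 q2 ^ 2 <= (u1 - u2) ^ 2 + (s1 - s2) ^ 2.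
Proof.
  intros Hu1 Hu2 H1 H2.
  pose proof (strip_ratio u2 Hu2) as Hl.
  pose proof (strip_dist_vertex _ _ _ Hu1 H1) as V.
  pose proof (strip_dist_base _ _ _ (strip_foot u2 s2) Hu1 H1) as W.
  specialize (H2 q1). rewrite (dist_sym q1 m), (dist_sym q1 (c _)), W in H2.
  assert (u2 / r * dist m q1 ^ 2 <= u2 / r * ((r - u1) ^ 2 + (s1 - s0) ^ 2))
    by (apply Rmult_le_compat_l; lra).
  eapply Rle_trans; [exact H2|].
  apply Rle_trans with (u2 / r * ((r - u1) ^ 2 + (s1 - s0) ^ 2)
    + (1 - u2 / r) * (u1 ^ 2 + (strip_foot u2 s2 - s1) ^ 2)
    - (1 - u2 / r) * (u2 / r) * (r ^ 2 + (strip_foot u2 s2 - s0) ^ 2)); [lra|].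
  apply Req_le. unfold strip_foot. field. lra.
Qed.

(** The Euclidean line through the two coordinate pairs meets [c] at time [t]. The distances from
    [c t] to [q1] and [q2] are known, and their difference is the Euclidean distance. Here [k] is
    the length of that line per unit of [u]. *)
Lemma strip_dist_ge_oblique (u1 s1 u2 s2 : R) (q1 q2 : X) :
  0 <= u1 -> u1 < u2 <= r / 2 ->
  strip_point u1 s1 q1 -> strip_point u2 s2 q2 ->
  (u1 - u2) ^ 2 + (s1 - s2) ^ 2 <= dist q1 q2 ^ 2.
Proof.
  intros Hu1 Hu2 H1 H2.
  set (t := s1 - u1 * (s2 - s1) / (u2 - u1)).
  set (E := sqrt ((u2 - u1) ^ 2 + (s2 - s1) ^ 2)).
  assert (HE0 : 0 <= E) by apply sqrt_pos.
  assert (HE : E ^ 2 = (u2 - u1) ^ 2 + (s2 - s1) ^ 2)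
    by (unfold E; apply pow2_sqrt; pose proof (pow2_ge_0 (u2 - u1));
        pose proof (pow2_ge_0 (s2 - s1)); lra).
  set (k := E / (u2 - u1)).
  assert (Hk : 0 <= k) by (apply Rdiv_le_0_compat; lra).
  assert (Ek : E = k * (u2 - u1)) by (unfold k; field; lra).
  assert (Hk2 : k ^ 2 = 1 + ((s2 - s1) / (u2 - u1)) ^ 2).
  { unfold k, Rdiv. rewrite Rpow_mult_distr, HE. field. lra. }
  assert (D1 : dist (c t) q1 <= k * u1).
  { apply le_of_sq_le; [nra|].
    rewrite (strip_dist_base u1 s1) by (assumption || lra).
    rewrite Rpow_mult_distr, Hk2. apply Req_le. unfold t. field. lra. }
  assert (D2 : k * u2 <= dist (c t) q2).
  { apply le_of_sq_le; [apply dist_nonneg|].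
    rewrite (strip_dist_base u2 s2) by (assumption || lra).
    rewrite Rpow_mult_distr, Hk2. apply Req_le. unfold t. field. lra. }
  pose proof (dist_triangle (c t) q1 q2).
  replace ((u1 - u2) ^ 2 + (s1 - s2) ^ 2) with (E ^ 2) by (rewrite HE; ring).
  apply pow_incr; lra.
Qed.

(** A parallel to [c] never meets it, so a far point [c t] takes the place of the intersection: its
    distances to [q1] and [q2] differ by almost [s2 - s1]. *)
Lemma strip_dist_ge_horizontal (u s1 s2 : R) (q1 q2 : X) :
  0 <= u <= r / 2 -> s1 < s2 -> strip_point u s1 q1 -> strip_point u s2 q2 ->
  s2 - s1 <= dist q1 q2.
Proof.
  intros Hu Hs H1 H2. apply Rnot_lt_le; intros C.
  set (d := dist q1 q2) in *. set (g := s2 - s1 - d).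
  assert (Hg : 0 < g) by (unfold g; lra).
  (* Far enough that [g * y] exceeds the error [2 * u * d] caused by the height [u]. *)
  set (y := 2 * u * d / g + 1).
  assert (Hd : 0 <= d) by apply dist_nonneg.
  assert (Hy : 0 < y) by (assert (0 <= 2 * u * d / g) by (apply Rdiv_le_0_compat; nra); unfold y; lra).
  set (t := s2 + y).
  pose proof (strip_dist_base u s1 q1 t Hu H1) as E1.
  pose proof (strip_dist_base u s2 q2 t Hu H2) as E2.
  pose proof (dist_triangle (c t) q2 q1) as T. rewrite (dist_sym q2 q1) in T. fold d in T.
  pose proof (dist_nonneg (c t) q1) as P1. pose proof (dist_nonneg (c t) q2) as P2.
  set (D1 := dist (c t) q1) in *. set (D2 := dist (c t) q2) in *.
  assert (B1 : D1 <= u + (t - s1)) by (apply le_of_sq_le; unfold t in *; nra).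
  assert (B2 : D2 <= u + (t - s2)) by (apply le_of_sq_le; unfold t in *; nra).
  assert (K : (D1 - D2) * (D1 + D2) = (s2 - s1) * (2 * t - s1 - s2))
    by (replace ((D1 - D2) * (D1 + D2)) with (D1 ^ 2 - D2 ^ 2) by ring; rewrite E1, E2; ring).
  assert (K1 : (D1 - D2) * (D1 + D2) <= d * (2 * u + (2 * t - s1 - s2))).
  { apply Rle_trans with (d * (D1 + D2)).
    - apply Rmult_le_compat_r; lra.
    - apply Rmult_le_compat_l; lra. }
  assert (K2 : g * y = 2 * u * d + g) by (unfold y; field; lra).
  assert (K3 : g * (2 * t - s1 - s2) <= 2 * u * d) by (unfold g; lra).
  assert (g * y <= g * (2 * t - s1 - s2)) by (apply Rmult_le_compat_l; unfold t; lra).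
  lra.
Qed.

Lemma strip_dist (u1 s1 u2 s2 : R) (q1 q2 : X) :
  0 <= u1 <= r / 2 -> 0 <= u2 <= r / 2 ->
  strip_point u1 s1 q1 -> strip_point u2 s2 q2 ->
  dist q1 q2 ^ 2 = (u1 - u2) ^ 2 + (s1 - s2) ^ 2.
Proof.
  intros Hu1 Hu2 H1 H2. apply Rle_antisym; [now apply strip_dist_le|].
  destruct (Rtotal_order u1 u2) as [L|[->|L]].
  - apply strip_dist_ge_oblique; auto; lra.
  - destruct (Rtotal_order s1 s2) as [L|[->|L]].
    + pose proof (strip_dist_ge_horizontal _ _ _ _ _ Hu1 L H1 H2).
      pose proof (dist_nonneg q1 q2). nra.
    + pose proof (pow2_ge_0 (dist q1 q2)). lra.
    + pose proof (strip_dist_ge_horizontal _ _ _ _ _ Hu1 L H2 H1) as K.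
      rewrite (dist_sym q2 q1) in K. pose proof (dist_nonneg q1 q2). nra.
  - replace ((u1 - u2) ^ 2 + (s1 - s2) ^ 2) with ((u2 - u1) ^ 2 + (s2 - s1) ^ 2) by ring.
    rewrite (dist_sym q1 q2). apply strip_dist_ge_oblique; auto; lra.
Qed.

Lemma flat_strip_of_vertex : bounds_flat_strip dist c.
Proof.
  assert (HF : forall u s, exists q, 0 <= u <= r / 2 -> strip_point u s q).
  { intros u s. destruct (classic (0 <= u <= r / 2)) as [Hu|Hu].
    - destruct (strip_point_exists u s ltac:(lra)) as (q & Hq). exists q; auto.
    (* An arbitrary value outside the strip. *)
    - exists m; tauto. }
  exists (r / 2), (fun u s => proj1_sig (constructive_indefinite_description _ (HF u s))).
  repeat split; [lra| |].
  - intros u1 u2 s1 s2 Hu1 Hu2.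
    destruct (constructive_indefinite_description _ (HF u1 s1)) as (q1 & K1).
    destruct (constructive_indefinite_description _ (HF u2 s2)) as (q2 & K2). simpl proj1_sig.
    now apply strip_dist; auto.
  - intros t. destruct (constructive_indefinite_description _ (HF 0 t)) as (q & K). simpl.
    symmetry; apply strip_point_base, K; lra.
Qed.

End FlatStrip.

(** [busemann_ge] at both ends bounds [dist m (c s) ^ 2] by one quadratic in [s], exact at [0];
    midpoint convexity makes it an equality. Completing the square puts the foot of [m] at time
    [- p m]. *)
Lemma flat_strip_of_busemann (c : R -> X) (p q : X -> R) (m : X) :
  geod_line dist c -> is_busemann (pend c) p -> is_busemann (mend c) q ->
  p m + q m <= 0 -> (forall s, m <> c s) -> bounds_flat_strip dist c.
Proof.
  intros Lc Hp Hq Hpq Hne.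
  set (d0 := dist m (c 0)).
  assert (U : forall s, dist m (c s) ^ 2 <= d0 ^ 2 + s ^ 2 + 2 * s * p m).
  { intros s. destruct (Rle_dec 0 s) as [Hs|Hs].
    - apply (busemann_ge _ _ (line_ray c Lc) Hp m s Hs).
    - pose proof (busemann_ge _ _ (line_mray c Lc) Hq m (- s) ltac:(lra)) as H.
      unfold mend in H. rewrite Ropp_involutive, Ropp_0 in H. fold d0 in H. nra. }
  assert (E : forall s, dist m (c s) ^ 2 = d0 ^ 2 + s ^ 2 + 2 * s * p m).
  { intros s. apply Rle_antisym; [apply U|].
    destruct (Rle_dec 0 s) as [Hs|Hs].
    - pose proof (line_midpoint c 0 s m Lc Hs) as H. fold d0 in H.
      rewrite Rplus_0_l in H. specialize (U (0 - s)). nra.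
    - pose proof (line_midpoint c 0 (- s) m Lc ltac:(lra)) as H. fold d0 in H.
      replace (0 - - s) with s in H by lra. specialize (U (0 + - s)). nra. }
  set (r := dist m (c (- p m))).
  assert (Hr : 0 < r).
  { destruct (Rle_lt_or_eq_dec 0 r (dist_nonneg _ _)) as [|K]; [assumption|].
    exfalso; apply (Hne (- p m)), dist_eq0. symmetry; exact K. }
  apply (flat_strip_of_vertex c Lc m r (- p m) Hr).
  intros s. unfold r. rewrite !E. ring.
Qed.

(** Otherwise compactness yields a limit point [l] of the sphere with [p l <= 0] and [q l <= 0]. On
    [c] this holds only at [c 0], so [l] lies off [c] and spans a flat strip. *)
Lemma rank_one_gap (c : R -> X) (p q : X -> R) (r : R) :
  geod_line dist c -> ~ bounds_flat_strip dist c ->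
  is_busemann (pend c) p -> is_busemann (mend c) q ->
  0 < r -> compact_set dist (fun y => dist (c 0) y <= r) ->
  exists d, 0 < d /\ forall x, dist (c 0) x = r -> p x <= d -> q x <= d -> False.
Proof.
  intros Lc Hn Hp Hq Hr HK. apply NNPP; intros N.
  assert (HU : forall n : nat, exists x,
    dist (c 0) x = r /\ p x <= / INR (S n) /\ q x <= / INR (S n)).
  { intros n. apply NNPP; intros C. apply N. exists (/ INR (S n)). split.
    - apply Rinv_0_lt_compat, lt_0_INR; lia.
    - intros x H1 H2 H3. apply C; eauto. }
  set (u := fun n => proj1_sig (constructive_indefinite_description _ (HU n))).
  assert (Hu : forall n, dist (c 0) (u n) = r /\ p (u n) <= / INR (S n) /\ q (u n) <= / INR (S n))
    by (intros n; unfold u; apply proj2_sig).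
  destruct (HK u) as (phi & l & Hphi & _ & Hl); [intros n; destruct (Hu n); lra|].
  assert (Happ : forall e, 0 < e -> exists n, dist (u n) l < e /\ / INR (S n) < e).
  { intros e He. destruct (Hl e He) as (M & HM).
    destruct (archimed_cor1 e He) as (k & Hk1 & Hk2).
    exists (phi (Nat.max M k)). split.
    - specialize (HM (Nat.max M k) ltac:(lia)). unfold Rdist in HM.
      rewrite Rminus_0_r, Rabs_pos_eq in HM by apply dist_nonneg. exact HM.
    - assert (Hge : forall n, (n <= phi n)%nat)
        by (induction n as [|n IH]; [lia|specialize (Hphi n); lia]).
      eapply Rle_lt_trans; [|exact Hk1].
      apply Rinv_le_contravar; [apply lt_0_INR; lia|].
      apply le_INR. specialize (Hge (Nat.max M k)). lia. }
  assert (Hdl : dist (c 0) l = r).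
  { apply cond_eq; intros e He. destruct (Happ e He) as (n & H1 & _).
    destruct (Hu n) as (H2 & _).
    pose proof (dist_triangle (c 0) (u n) l). pose proof (dist_triangle (c 0) l (u n)).
    rewrite (dist_sym l) in *. apply Rabs_def1; lra. }
  assert (Hpl : p l <= 0).
  { apply Rle_plus_epsilon; intros e He. destruct (Happ (e / 2) ltac:(lra)) as (n & H1 & H2).
    destruct (Hu n) as (_ & H3 & _).
    pose proof (busemann_lipschitz _ _ Hp l (u n)). rewrite (dist_sym l) in *. lra. }
  assert (Hql : q l <= 0).
  { apply Rle_plus_epsilon; intros e He. destruct (Happ (e / 2) ltac:(lra)) as (n & H1 & H2).
    destruct (Hu n) as (_ & _ & H3).
    pose proof (busemann_lipschitz _ _ Hq l (u n)). rewrite (dist_sym l) in *. lra. }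
  apply Hn, (flat_strip_of_busemann c p q l); auto; [lra|].
  intros s ->. rewrite (busemann_pend c p) in Hpl by assumption.
  rewrite (busemann_mend c q) in Hql by assumption.
  assert (s = 0) by lra; subst s. rewrite dist_refl in Hdl. lra.
Qed.

(** * Stability of Busemann functions and of the minimum of their sum *)

Lemma busemann_cone_near (r1 r2 : R -> X) (b1 b2 : X -> R) (x : X) (T e D : R) :
  geod_ray dist r1 -> geod_ray dist r2 -> r1 0 = r2 0 ->
  is_busemann r1 b1 -> is_busemann r2 b2 ->
  0 < T -> dist (r1 T) (r2 T) < e -> dist x (r1 0) <= D ->
  Rabs (b1 x - b2 x) <= e + D ^ 2 / (2 * T).
Proof.
  intros Hr1 Hr2 H0 Hb1 Hb2 HT He HD.
  (* Each function lies below its value read off at time [T] by at most [D ^ 2 / (2 * T)], and the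
     two readings differ by less than [e]. *)
  pose proof (busemann_estimate _ _ Hr1 Hb1 x T HT) as L1.
  pose proof (busemann_estimate _ _ Hr2 Hb2 x T HT) as L2.
  pose proof (busemann_le _ _ Hr1 Hb1 x T ltac:(lra)) as U1.
  pose proof (busemann_le _ _ Hr2 Hb2 x T ltac:(lra)) as U2.
  rewrite <- H0 in L2.
  assert (dist x (r1 0) ^ 2 / (2 * T) <= D ^ 2 / (2 * T)).
  { apply Rmult_le_compat_r; [apply Rlt_le, Rinv_0_lt_compat; lra|].
    apply pow_incr; split; [apply dist_nonneg|assumption]. }
  pose proof (dist_triangle x (r1 T) (r2 T)).
  pose proof (dist_triangle x (r2 T) (r1 T)). rewrite (dist_sym (r2 T)) in *.
  apply Rabs_le; lra.
Qed.

Lemma geodesic_crosses_sphere (x z : X) (r : R) :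
  0 < r < dist x z -> exists s l,
    geod_segment dist x z s /\ 0 <= l <= 1 /\ dist x (s (l * dist x z)) = r.
Proof.
  intros Hr. destruct (proj1 Hc x z) as (s & Hs).
  exists s, (r / dist x z). split; [exact Hs|].
  destruct Hs as (Hs0 & _ & Hs).
  replace (r / dist x z * dist x z) with r by (field; lra). repeat split.
  - apply Rdiv_le_0_compat; lra.
  - apply (Rmult_le_reg_r (dist x z)); [lra|].
    unfold Rdiv; rewrite Rmult_assoc, Rinv_l; lra.
  - rewrite <- Hs0 at 1. rewrite Hs, Rabs_minus_sym, Rabs_pos_eq; lra.
Qed.

(** [p], [q] are the Busemann functions of the ends of the line [c], [p'], [q']
    those of a nearby line [c'].  The point [z] of [c'] on the [p']-horosphere
    through [c 0] cannot leave the ball: otherwise the geodesic from [c 0] to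
    [z] meets the sphere where both [p] and [q] are almost nonpositive. *)
Lemma busemann_sum_min_near (c c' rp rq : R -> X) (p q p' q' : X -> R) (r d k : R) :
  is_busemann (pend c) p -> is_busemann (mend c) q -> geod_line dist c ->
  geod_line dist c' -> asym dist rp (pend c') -> asym dist rq (mend c') ->
  is_busemann rp p' -> is_busemann rq q' -> geod_ray dist rp -> geod_ray dist rq ->
  0 < r ->
  (forall x, dist (c 0) x = r -> p x <= d -> q x <= d -> False) ->
  (forall x, dist (c 0) x <= r ->
     Rabs (p x - (p' x - p' (c 0))) <= k /\ Rabs (q x - (q' x - q' (c 0))) <= k) ->
  k <= d ->
  p' (c 0) + q' (c 0) - 2 * k <= p' (c' 0) + q' (c' 0) <= p' (c 0) + q' (c 0).
Proof.
  intros Hp Hq Lc Lc' Arp Arq Hp' Hq' Hrp Hrq Hr Hgap Hk Hkd.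
  split; [|now apply (busemann_sum_min c' rp rq)].
  (* As [p'] falls at unit speed along [c'], this time gives [p' z = p' (c 0)]; minimality of the
     sum on [c'] then gives [q' z <= q' (c 0)]. *)
  set (s := p' (c' 0) - p' (c 0)). set (z := c' s).
  pose proof (busemann_along_pend c' rp p' s Lc' Arp Hp') as Ez1. fold z in Ez1.
  pose proof (busemann_along_mend c' rq q' s Lc' Arq Hq') as Ez2. fold z in Ez2.
  pose proof (busemann_sum_min c' rp rq p' q' s (c 0) Lc' Arp Arq Hp' Hq') as Ez3. fold z in Ez3.
  destruct (Rle_lt_dec (dist (c 0) z) r) as [Hz|Hz].
  - destruct (Hk z Hz) as (K1 & K2). apply Rabs_le_between in K1. apply Rabs_le_between in K2.
    pose proof (busemann_sum_min c (pend c) (mend c) p q 0 z Lc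
      (asym_refl _) (asym_refl _) Hp Hq) as F.
    rewrite (busemann_pend c p), (busemann_mend c q) in F by assumption.
    unfold s in *; lra.
  - exfalso. destruct (geodesic_crosses_sphere (c 0) z r ltac:(lra)) as (g & l & Hg & Hl & Hgr).
    assert (Q1 : p' (g (l * dist (c 0) z)) <= p' (c 0))
      by (apply (busemann_quasiconvex rp p' Hrp Hp'); auto; unfold s in *; lra).
    assert (Q2 : q' (g (l * dist (c 0) z)) <= q' (c 0))
      by (apply (busemann_quasiconvex rq q' Hrq Hq'); auto; unfold s in *; lra).
    destruct (Hk _ (Req_le _ _ Hgr)) as (K1 & K2).
    apply Rabs_le_between in K1. apply Rabs_le_between in K2.
    apply (Hgap _ Hgr); lra.
Qed.

(** The lines [a], [b], [e] form a chain: the first two share [a]'s negative end, the last two share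
    [b]'s positive end. *)
Lemma strictly_rank_one_scissors (a b c e : R -> X) (x : X) :
  strictly_rank_one dist a -> scissors dist a b c e x -> ~ bounds_flat_strip dist e.
Proof.
  intros Ha (La & Lb & _ & Le & Aab & _ & _ & Abe & _) H.
  apply Ha. exists 2%nat, (fun i => match i with 0%nat => a | 1%nat => b | _ => e end).
  repeat split; auto.
  - intros [|[|i]] _; auto.
  - intros [|[|i]] Hi; [| |lia].
    + exists (mend a), (mend b); auto.
    + exists (pend b), (pend e); auto.
Qed.

End CAT0Space.

(** * Continuity of the displacement *)

Theorem theorem10 (X : Type) (dist : X -> X -> R) (a : R -> X) :
  is_metric dist -> CAT0 dist -> locally_compact dist ->
  geodesically_complete dist -> connected_at_infinity dist ->
  geod_line dist a -> strictly_rank_one dist a ->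
  forall (o : X) (xi0 eta0 : R -> X) (x0 : X) (v0 : R),
    delta_rel dist a xi0 eta0 x0 v0 ->
    forall eps, 0 < eps ->
    exists Rr eps' rho, 0 <= Rr /\ 0 < eps' /\ 0 < rho /\
      forall (xi eta : R -> X) (x : X) (v : R),
        delta_rel dist a xi eta x v ->
        cone_near dist o xi0 xi Rr eps' ->
        cone_near dist o eta0 eta Rr eps' ->
        dist x0 x < rho ->
        Rabs (v - v0) < eps.
Proof.
  intros Hm Hc Hlc _ _ La Ha o xi0 eta0 x0 v0
    (_ & _ & b0 & c0 & e0 & S0 & Ab0 & Ac0 & V0) eps Heps.
  pose proof (strictly_rank_one_scissors dist _ _ _ _ _ Ha S0) as Hn.
  assert (S0' := S0). destruct S0' as (_ & _ & _ & Le0 & _ & _ & Ace0 & Abe0 & _).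
  destruct (Hlc (e0 0)) as (r & Hr & HK).
  destruct (busemann_exists dist Hm _ (line_ray dist e0 Le0)) as (p & Hp).
  destruct (busemann_exists dist Hm _ (line_mray dist e0 Le0)) as (q & Hq).
  destruct (busemann_exists dist Hm _ (line_ray dist a La)) as (ap & Hap).
  destruct (busemann_exists dist Hm _ (line_mray dist a La)) as (am & Ham).
  destruct (rank_one_gap dist Hm Hc e0 p q r Le0 Hn Hp Hq Hr HK) as (d & Hd & Hgap).
  pose proof (displacement_eq dist Hm Hc _ _ _ _ _ _ _ _ _ _ _ _ S0 V0 Hap Ham
    (asym_refl dist Hm _) (asym_refl dist Hm _) Hp Hq) as Ev0.
  rewrite (busemann_pend dist e0 p), (busemann_mend dist e0 q) in Ev0 by assumption.
  (* The bound [d / 2] ensures [2 * k <= d], as the stability of the minimum requires; [eps / 32]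
     serves the final error count. *)
  set (k := Rmin (eps / 32) (d / 2)).
  assert (Hk : 0 < k <= eps / 32 /\ k <= d / 2).
  { unfold k. pose proof (Rmin_l (eps / 32) (d / 2)); pose proof (Rmin_r (eps / 32) (d / 2)).
    repeat split; auto. apply Rmin_glb_lt; lra. }
  (* The ball of radius [D] about [o] contains both [x0] and the ball of radius [r] about [e0 0]. *)
  set (D := dist o (e0 0) + r + dist o x0).
  pose proof (dist_nonneg dist Hm) as Nn.
  assert (HD : 0 < D) by (unfold D; pose proof (Nn o (e0 0)); pose proof (Nn o x0); lra).
  (* With this [T] the error [D ^ 2 / (2 * T)] equals [k / 2]; the other half of [k] is the cone
     radius. *)
  set (T := D ^ 2 / k).
  assert (HT : 0 < T) by (apply Rdiv_lt_0_compat; [apply pow_lt|]; lra).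
  exists T, (k / 2), (eps / 16). repeat split; try lra.
  intros xi eta x v (_ & _ & b & c & e & S & Ab & Ac & V) Hxi Heta Hx.
  assert (S' := S). destruct S' as (_ & _ & _ & Le & _ & _ & Ace & Abe & _).
  destruct Hxi as (r0 & r1 & Hr0 & Hr1 & O0 & O1 & A0 & A1 & N1).
  destruct Heta as (t0 & t1 & Ht0 & Ht1 & P0 & P1 & B0 & B1 & N2).
  pose proof (asym_sym dist Hm) as As. pose proof (asym_trans dist Hm) as At.
  assert (A0' : asym dist r0 (pend e0)) by eauto 6.
  assert (A1' : asym dist r1 (pend e)) by eauto 6.
  assert (B0' : asym dist t0 (mend e0)) by eauto 6.
  assert (B1' : asym dist t1 (mend e)) by eauto 6.
  destruct (busemann_exists dist Hm _ Hr0) as (f0 & Hf0).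
  destruct (busemann_exists dist Hm _ Hr1) as (f1 & Hf1).
  destruct (busemann_exists dist Hm _ Ht0) as (g0 & Hg0).
  destruct (busemann_exists dist Hm _ Ht1) as (g1 & Hg1).
  pose proof (displacement_eq dist Hm Hc _ _ _ _ _ _ _ _ _ _ _ _ S V Hap Ham
    A1' B1' Hf1 Hg1) as Ev.
  assert (ET : k / 2 + D ^ 2 / (2 * T) = k) by (unfold T; field; lra).
  assert (Near : forall y, dist y o <= D ->
    Rabs (f0 y - f1 y) <= k /\ Rabs (g0 y - g1 y) <= k).
  { intros y Hy. rewrite <- ET. split.
    - apply (busemann_cone_near dist Hm Hc r0 r1); congruence || auto.
    - apply (busemann_cone_near dist Hm Hc t0 t1); congruence || auto. }
  (* Since [p] and [q] vanish at [e0 0], the functions of the rays from [o] are renormalised there,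
     which doubles the error. *)
  assert (Hdiff : forall y, dist y o <= D ->
    Rabs (p y - (f1 y - f1 (e0 0))) <= 2 * k /\ Rabs (q y - (g1 y - g1 (e0 0))) <= 2 * k).
  { intros y Hy. destruct (Near y Hy) as (K1 & K2).
    destruct (Near (e0 0)) as (K3 & K4).
    { rewrite (dist_sym dist Hm). unfold D. pose proof (Nn o x0). lra. }
    pose proof (busemann_asym dist Hm Hc _ _ _ _ y (e0 0) A0' Hf0 Hp) as E1.
    pose proof (busemann_asym dist Hm Hc _ _ _ _ y (e0 0) B0' Hg0 Hq) as E2.
    rewrite (busemann_pend dist e0 p) in E1 by assumption.
    rewrite (busemann_mend dist e0 q) in E2 by assumption.
    apply Rabs_le_between in K1; apply Rabs_le_between in K2;
    apply Rabs_le_between in K3; apply Rabs_le_between in K4.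
    split; apply Rabs_le; lra. }
  assert (Hmin := busemann_sum_min_near dist Hm Hc e0 e r1 t1 p q f1 g1 r d (2 * k)
    Hp Hq Le0 Le A1' B1' Hf1 Hg1 Hr1 Ht1 Hr Hgap).
  destruct Hmin as (M1 & M2).
  { intros y Hy. apply Hdiff. pose proof (dist_triangle dist Hm y (e0 0) o) as K.
    rewrite (dist_sym dist Hm y (e0 0)), (dist_sym dist Hm (e0 0) o) in K.
    unfold D. pose proof (Nn o x0). lra. }
  { lra. }
  destruct (Hdiff x0) as (K1 & K2).
  { rewrite (dist_sym dist Hm). unfold D. pose proof (Nn o (e0 0)). lra. }
  apply Rabs_le_between in K1; apply Rabs_le_between in K2.
  pose proof (fun r b (H : is_busemann dist r b) => conj
    (busemann_lipschitz dist Hm r b H x0 x) (busemann_lipschitz dist Hm r b H x x0)) as Lip.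
  rewrite (dist_sym dist Hm x x0) in Lip.
  destruct (Lip _ _ Hap), (Lip _ _ Ham), (Lip _ _ Hf1), (Lip _ _ Hg1).
  (* Moving from [x0] to [x] costs less than [4 * (eps / 16)], replacing [p] and [q] at [x0] costs
     [4 * k], and the minimum costs another [4 * k]; the total is below [eps / 2]. *)
  apply Rabs_def1; lra.
Qed.
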